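(* For every integer $n \geq 3$, if $C_n$ is the cycle of order $n$, then $d(C_n) = \lceil \frac{n}{2} \rceil$.
   Context: Graphs are finite and simple. The deduction game on a graph $G$: a layout is a placement of searchers on vertices of $G$ (a vertex may receive several searchers). A vertex is occupied in the layout if it contains at least one searcher, and unoccupied otherwise. A vertex is protected if it is occupied in the initial layout or if a searcher has moved there at some point, and unprotected otherwise. A vertex is fireable if the number of searchers on it is greater than or equal to the number of its unprotected neighbours. Initially every searcher is mobile; once a searcher has moved once, it becomes immobile (cannot move again). At each stage, simultaneously, for every fireable vertex $v$ containing mobile searchers, one searcher moves from $v$ to each unprotected neighbour of $v$ (excess searchers stay on $v$; several fireable vertices may send a searcher to the same target). Stages continue until no new searchers move. The layout is successful if at the end all vertices of $G$ are protected. The deduction number $d(G)$ is the minimum number of searchers in a successful layout on $G$. *)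

(* Defs.v *)
From mathcomp Require Import all_boot.

Set Implicit Arguments.
Unset Strict Implicit.
Unset Printing Implicit Defensive.

Record sgraph := SGraph {
  svertex :> finType;
  adj : rel svertex;
  adj_sym : symmetric adj;
  adj_irrefl : irreflexive adj }.

Section DeductionGame.
Variable G : sgraph.

Record state := State {
  mobile : {ffun G -> nat};
  immobile : {ffun G -> nat};
  protected : {set G} }.

Definition searchers (s : state) (v : G) : nat := mobile s v + immobile s v.

Definition unprotected_nbrs (s : state) (v : G) : {set G} :=
  [set w | adj v w & w \notin protected s].

Definition fireable (s : state) (v : G) : bool :=
  #|unprotected_nbrs s v| <= searchers s v.

Definition fires (s : state) (v : G) : bool := fireable s v && (0 < mobile s v).

(* The vertices from which a searcher moves to w during the stage. *)
Definition senders (s : state) (w : G) : {set G} :=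
  [set v | fires s v & w \in unprotected_nbrs s v].

(* A vertex never holds mobile and immobile searchers together (see
   [mobile_immobile] below), so the subtraction is never truncated. *)
Definition stage (s : state) : state := {|
  mobile := [ffun v => if fires s v then mobile s v - #|unprotected_nbrs s v|
                       else mobile s v];
  immobile := [ffun w => immobile s w + #|senders s w|];
  protected := protected s :|: [set w | senders s w != set0] |}.

Definition stopped (s : state) : bool := [forall w, senders s w == set0].

Section Layout.
Variables (k : nat) (L : {ffun 'I_k -> G}).

Definition initial : state := {|
  mobile := [ffun v => #|[set i | L i == v]|];
  immobile := [ffun => 0];
  protected := [set L i | i : 'I_k] |}.

(* Each stage in which a searcher moves protects a new vertex, so the game has
   stopped after #|G| stages; see [final_stopped] and [successfulP]. *)
Definition final : state := iter #|G| stage initial.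

Definition successful : bool := protected final == [set: G].

End Layout.

Lemma stage_stopped s : stopped s -> protected (stage s) = protected s.
Proof.
move/forallP=> h; apply/setP=> w; rewrite !inE.
by rewrite (eqP (h w)) eqxx orbF.
Qed.

Lemma stage_fix s : stopped s -> stage s = s.
Proof.
move=> h; have hP := stage_stopped h; case: s h hP => m i p h hP.
have fE v : fires (State m i p) v -> unprotected_nbrs (State m i p) v = set0.
  move=> fv; apply/setP=> w; rewrite [RHS]inE; apply/negP=> wv.
  move/forallP/(_ w)/eqP/setP/(_ v): h.
  by rewrite !inE fv /=; move: wv; rewrite inE => ->.
rewrite -[RHS]/(State m i p) /stage; congr State; last exact: hP.
- apply/ffunP=> v; rewrite ffunE; case: ifP => //= /fE ->.
  by rewrite cards0 subn0.
- apply/ffunP=> w; rewrite ffunE.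
  by move/forallP/(_ w)/eqP: h => ->; rewrite cards0 addn0.
Qed.

Lemma stage_grow s : ~~ stopped s -> #|protected s| < #|protected (stage s)|.
Proof.
case/forallPn=> w hw; apply: proper_card; rewrite properE subsetUl /=.
apply/subsetPn; exists w; first by rewrite !inE hw orbT.
by case/set0Pn: hw => v; rewrite !inE => /and3P[].
Qed.

Lemma stopped_or_big t s :
  stopped (iter t stage s) || (t <= #|protected (iter t stage s)|).
Proof.
elim: t => [|t IH]; first by rewrite orbT.
rewrite iterS; have [st|nst] := boolP (stopped (iter t stage s)).
  by rewrite stage_fix // st.
move: IH; rewrite (negPf nst) /= => le_t; apply/orP; right.
exact: leq_ltn_trans le_t (stage_grow nst).
Qed.

Lemma final_stopped k (L : {ffun 'I_k -> G}) : stopped (final L).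
Proof.
have /orP[//|big] := stopped_or_big #|G| (initial L).
apply/forallP=> w; apply/eqP/setP=> v; rewrite !inE.
have /eqP -> : protected (final L) == setT.
  by rewrite eqEcard subsetT cardsT.
by rewrite inE !andbF.
Qed.

Lemma stopped_unique t u s :
  stopped (iter t stage s) -> stopped (iter u stage s) ->
  iter t stage s = iter u stage s.
Proof.
have aux a b : a <= b -> stopped (iter a stage s) ->
    iter a stage s = iter b stage s.
  move=> /subnK <- st; elim: (b - a) => //= c <-.
  by rewrite stage_fix.
by case/orP: (leq_total t u) => le_tu ht hu; [|symmetry]; apply: aux.
Qed.

Lemma successfulP k (L : {ffun 'I_k -> G}) :
  reflect (exists2 t, stopped (iter t stage (initial L))
             & protected (iter t stage (initial L)) = [set: G])
          (successful L).
Proof.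
apply: (iffP eqP) => [P|[t st Pt]].
  by exists #|G|; first exact: final_stopped.
by rewrite /final (stopped_unique (final_stopped L) st).
Qed.

Lemma mobile_immobile k (L : {ffun 'I_k -> G}) t v :
  (mobile (iter t stage (initial L)) v == 0)
  || (immobile (iter t stage (initial L)) v == 0).
Proof.
set s := iter t _ _.
suff: ((mobile s v == 0) || (immobile s v == 0))
      && ((0 < mobile s v) ==> (v \in protected s)) by case/andP.
rewrite {}/s; elim: t => [|t] /=.
  rewrite !ffunE eqxx orbT /=; apply/implyP=> /card_gt0P[i].
  by rewrite inE => /eqP <-; apply: imset_f.
move: (iter t _ _) => s /andP[/orP h1 /implyP h2].
have le_m : mobile (stage s) v <= mobile s v.
  by rewrite ffunE; case: ifP => // _; apply: leq_subr.
case: (posnP (mobile s v)) => [m0|mp].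
  by move: le_m; rewrite m0 leqn0 => /eqP ->.
have vP := h2 mp; apply/andP; split; last by rewrite !inE vP implybT.
apply/orP; right; rewrite ffunE.
have -> : senders s v = set0 by apply/setP=> u; rewrite !inE vP !andbF.
by rewrite cards0 addn0; case: h1 mp => // /eqP ->.
Qed.

Definition has_successful_layout (k : nat) : bool :=
  [exists L : {ffun 'I_k -> G}, successful L].

Lemma has_successful_layout_ex : exists k, has_successful_layout k.
Proof.
exists #|G|; apply/existsP; exists [ffun i => enum_val i].
have P w : w \in protected (initial [ffun i => @enum_val G G i]).
  by apply/imsetP; exists (enum_rank w); rewrite ?ffunE ?enum_rankK.
apply/successfulP; exists 0; last by apply/setP=> v; rewrite [RHS]inE; apply: P.
apply/forallP=> w; apply/eqP/setP=> v.
by rewrite [RHS]inE [LHS]inE [in LHS]inE (P w) /= !andbF.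
Qed.

Definition deduction_number : nat := ex_minn has_successful_layout_ex.

End DeductionGame.

(* The condition i != j only matters for n = 1, where it removes the loop. *)
Definition cycle_adj (n : nat) : rel 'I_n :=
  fun i j => (i != j) && ((i.+1 %% n == j) || (j.+1 %% n == i)).

Lemma cycle_adj_sym n : symmetric (@cycle_adj n).
Proof. by move=> i j; rewrite /cycle_adj eq_sym orbC. Qed.

Lemma cycle_adj_irrefl n : irreflexive (@cycle_adj n).
Proof. by move=> i; rewrite /cycle_adj eqxx. Qed.

Definition cycle_graph (n : nat) : sgraph :=
  SGraph (@cycle_adj_sym n) (@cycle_adj_irrefl n).

(* Main.v *)
Require Import Defs.
From mathcomp Require Import all_boot.
From mathcomp Require Import zify.

(** The lower bound holds on every graph: a searcher moves at most once, so it
    accounts for at most two protected vertices, the one it starts from and the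
    one it moves to.  Hence a graph with a successful layout of [k] searchers
    has at most [2 * k] vertices ([leq_card_successful]).

    On the cycle this is attained by single searchers on 0, 1, 3, 5, ...  The
    two adjacent searchers start the game: 0 has the only unprotected
    neighbour [n - 1] and 1 the only unprotected neighbour 2.  Once 2 is
    protected, 3 can send its searcher to 4, then 5 to 6, and so on around the
    cycle.  This chain reaction need not be followed stage by stage: it is
    enough that in the final state, where nothing moves any more, an initially
    occupied vertex with at most one unprotected neighbour has none
    ([final_unprotected_nbrs]).  Induction along the cycle then shows that
    every vertex is protected in the end. *)

Section Game.
Variable G : sgraph.
Implicit Types (s : state G) (v w : G).

Lemma unprotected_nbrs_stage s v :
  unprotected_nbrs (stage s) v \subset unprotected_nbrs s v.
Proof.
apply/subsetP=> w; rewrite !inE => /andP[-> /=].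
by rewrite negb_or => /andP[].
Qed.

Lemma fires_unprotected_nbrs s v :
  fires s v -> unprotected_nbrs (stage s) v = set0.
Proof.
move=> fv; apply/setP=> w; rewrite [in RHS]inE.
apply/negP=> wv; have ws := subsetP (unprotected_nbrs_stage s v) w wv.
move: wv; rewrite inE => /andP[_]; rewrite inE negb_or inE negbK => /andP[_].
by move/eqP/setP/(_ v); rewrite [in RHS]inE inE fv ws.
Qed.

Lemma stopped_fires s v : stopped s -> fires s v -> unprotected_nbrs s v = set0.
Proof. by move=> st /fires_unprotected_nbrs; rewrite stage_fix. Qed.

Section Layout.
Variables (k : nat) (L : {ffun 'I_k -> G}).
Notation play t := (iter t (@stage G) (initial L)).

Lemma initial_protected t w :
  w \in [set L i | i : 'I_k] -> w \in protected (play t).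
Proof. by move=> wL; elim: t => //= t IH; rewrite inE IH. Qed.

(** The only way for a vertex to lose mobile searchers is to fire, and firing
    protects all of its neighbours. *)
Lemma mobile_play t v :
  mobile (play t) v = mobile (initial L) v \/ unprotected_nbrs (play t) v = set0.
Proof.
elim: t => [|t IH]; first by left.
rewrite iterS; have [fv|nfv] := boolP (fires (play t) v).
  by right; apply: fires_unprotected_nbrs.
case: IH => [mE|U0]; first by left; rewrite ffunE (negPf nfv).
by right; apply/eqP; rewrite -subset0 -U0 unprotected_nbrs_stage.
Qed.

(** A vertex that never fired still holds its initial searcher, so with at most
    one unprotected neighbour it would fire, whereas the game is over. *)
Lemma final_unprotected_nbrs v :
  v \in [set L i | i : 'I_k] -> #|unprotected_nbrs (final L) v| <= 1 ->
  unprotected_nbrs (final L) v = set0.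
Proof.
move=> /imsetP[i _ vE] U1; case: (mobile_play #|G| v) => [mE|//].
have m0 : 0 < mobile (final L) v.
  by rewrite /final mE ffunE; apply/card_gt0P; exists i; rewrite inE vE.
apply: stopped_fires; first exact: final_stopped.
rewrite /fires m0 andbT /fireable.
by apply: leq_trans U1 _; apply: leq_trans m0 _; apply: leq_addr.
Qed.

(** How protection spreads along a cycle: once [w0], one of the two
    neighbours of [v], is protected, at most [w] is left for the searcher on
    [v]. *)
Lemma final_nbr_protected v w0 w :
  v \in [set L i | i : 'I_k] ->
  (forall u, adj v u -> u = w0 \/ u = w) -> w0 \in protected (final L) ->
  adj v w -> w \in protected (final L).
Proof.
move=> vL nbrs w0P vw; apply/negPn/negP=> wP.
suff U0 : unprotected_nbrs (final L) v = set0.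
  by move/setP/(_ w): U0; rewrite !inE vw wP.
apply: final_unprotected_nbrs => //; rewrite -(cards1 w); apply: subset_leq_card.
apply/subsetP=> u; rewrite !inE => /andP[/nbrs[]-> // ].
by rewrite w0P.
Qed.

(** A mobile searcher keeps one protected vertex in reserve.  A vertex that
    fires spends one searcher per unprotected neighbour, and these neighbours
    cover the newly protected vertices, possibly several times. *)
Lemma protected_mobile_bound t :
  #|protected (play t)| + \sum_v mobile (play t) v <= k.*2.
Proof.
elim: t => [|t IH].
  rewrite /= -addnn leq_add //.
    by apply: leq_trans (leq_imset_card _ _) _; rewrite card_ord.
  rewrite -[leqRHS]card_ord -[leqRHS]sum1_card (partition_big L xpredT) //=.
  rewrite leq_eqVlt; apply/orP; left; apply/eqP; apply: eq_bigr => v _.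
  by rewrite ffunE -sum1_card; apply: eq_bigl => i; rewrite inE.
rewrite iterS; set s := play t in IH *; apply: leq_trans IH.
have -> : \sum_v mobile s v =
    \sum_(v | fires s v) #|unprotected_nbrs s v| + \sum_v mobile (stage s) v.
  rewrite [X in X + _]big_mkcond -big_split; apply: eq_bigr => v _ /=; rewrite ffunE.
  case: ifP => // /andP[]; rewrite /fireable /searchers.
  (* Since [v] has mobile searchers it has no immobile ones, so the subtraction
     in [stage] is exact. *)
  have /orP[/eqP->//|/eqP->] := mobile_immobile L t v.
  by rewrite addn0 => /subnKC.
rewrite addnA leq_add2r; apply: leq_trans (leq_card_setU _ _) _.
rewrite leq_add2l.
(* Each move is counted once by its origin and once by its target. *)
have -> : \sum_(v | fires s v) #|unprotected_nbrs s v| = \sum_w #|senders s w|.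
  under eq_bigr do rewrite -sum1_card.
  under [RHS]eq_bigr do rewrite -sum1_card.
  rewrite (exchange_big_dep xpredT) //=.
  by apply: eq_bigr => w _; apply: eq_bigl => v; rewrite [RHS]inE.
rewrite -sum1_card big_mkcond; apply: leq_sum => w _ /=.
by rewrite inE; case: ifP => //; rewrite card_gt0.
Qed.

Lemma leq_card_successful : successful L -> #|G| <= k.*2.
Proof.
move=> /eqP PT; apply: leq_trans (protected_mobile_bound #|G|).
by rewrite -[play _]/(final L) PT cardsT leq_addr.
Qed.

End Layout.
End Game.

Section Cycle.
Variables (n : nat) (n_ge3 : 3 <= n).
Notation C := (cycle_graph n).

Lemma cycle_adj_succ (i j : C) : i.+1 = j -> adj i j.
Proof.
move=> ij; apply/andP; split; last by rewrite ij modn_small ?ltn_ord ?eqxx.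
by apply/eqP=> ij'; move: ij; rewrite ij'; lia.
Qed.

(** Splitting off the wrap-around between 0 and [n - 1] leaves only linear
    conditions instead of the remainders modulo [n]. *)
Lemma cycle_adj_cases (i j : C) : adj i j ->
  [\/ i.+1 = j :> nat, j.+1 = i :> nat,
      i = 0 :> nat /\ j.+1 = n | j = 0 :> nat /\ i.+1 = n].
Proof.
have wrap (a b : C) : a.+1 %% n = b -> a.+1 = b :> nat \/ b = 0 :> nat /\ a.+1 = n.
  have := ltn_ord a; rewrite leq_eqVlt => /orP[/eqP an|an].
    by rewrite an modnn => <-; right.
  by rewrite modn_small // => <-; left.
case/andP=> _ /orP[] /eqP /wrap[h|h].
- exact: Or41.
- exact: Or44.
- exact: Or42.
- exact: Or43.
Qed.

Lemma searcher_position_subproof (i : 'I_(uphalf n)) : i.*2.-1 < n.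
Proof. by have := ltn_ord i; lia. Qed.

(** The values are 0, 1, 3, 5, ...: the predecessor of 0 is 0. *)
Definition searcher_position (i : 'I_(uphalf n)) : C :=
  Ordinal (searcher_position_subproof i).

Definition cycle_layout : {ffun 'I_(uphalf n) -> C} :=
  [ffun i => searcher_position i].

Lemma cycle_layout_occupied (v : C) :
  v = 0 :> nat \/ odd v /\ v.+1 < n -> v \in [set cycle_layout i | i : 'I__].
Proof.
move=> vP; have vi : uphalf v < uphalf n by case: vP; lia.
apply/imsetP; exists (Ordinal vi) => //; apply: val_inj; rewrite ffunE /=.
by case: vP => [->|]; lia.
Qed.

Notation P := (protected (final cycle_layout)).

Lemma cycle_occupied_protected (v : C) :
  v = 0 :> nat \/ odd v /\ v.+1 < n -> v \in P.
Proof. by move=> /cycle_layout_occupied; apply: initial_protected. Qed.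

(** The chain reaction: once an even vertex [v] is protected, the searcher on the
    odd vertex [v + 1] is free to protect [v + 2]. *)
Lemma cycle_even_protected (v : C) : ~~ odd v -> v \in P.
Proof.
have [m] := ubnP (v : nat); elim: m v => // m IH v vm v_even.
have [v0|v_gt0] := posnP v; first by apply: cycle_occupied_protected; left.
have v_lt := ltn_ord v.
have u_lt : v.-1 < n by lia.
have w_lt : v.-2 < n by lia.
pose u : C := Ordinal u_lt; pose w : C := Ordinal w_lt.
apply: (@final_nbr_protected _ _ _ u w v).
- by apply: cycle_layout_occupied; right; rewrite /u /=; lia.
- move=> x /cycle_adj_cases ux.
  have [xw|xv] : x = w :> nat \/ x = v :> nat.
    by move: ux; rewrite /u /w /=; case; lia.
  - by left; apply: val_inj.
  - by right; apply: val_inj.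
- by apply: IH; rewrite /w /=; lia.
- by apply: cycle_adj_succ; rewrite /u /=; lia.
Qed.

Lemma cycle_layout_successful : successful cycle_layout.
Proof.
apply/eqP/setP=> v; rewrite [RHS]inE.
have [v_odd|] := boolP (odd v); last exact: cycle_even_protected.
have [v_lt|v_last] := ltnP v.+1 n; first by apply: cycle_occupied_protected; right.
have v_lt := ltn_ord v.
have lt0 : 0 < n by lia.
have lt1 : 1 < n by lia.
pose u : C := Ordinal lt0; pose w : C := Ordinal lt1.
(* For even [n] the last vertex is odd and unoccupied: its searcher comes from
   0, whose other neighbour 1 is occupied from the start. *)
apply: (@final_nbr_protected _ _ _ u w v).
- by apply: cycle_layout_occupied; left.
- move=> x /cycle_adj_cases ux.
  have [xw|xv] : x = w :> nat \/ x = v :> nat.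
    by move: ux; rewrite /u /w /=; case; lia.
  - by left; apply: val_inj.
  - by right; apply: val_inj.
- by apply: cycle_occupied_protected; right; rewrite /w /=; lia.
- have vn : v.+1 = n by lia.
  apply/andP; split; last by rewrite vn modnn eqxx orbT.
  by apply/eqP=> uv; move: v_odd; rewrite -uv.
Qed.

End Cycle.

Theorem theorem4p2 (n : nat) (hn : 3 <= n) :
  deduction_number (cycle_graph n) = uphalf n.
Proof.
rewrite /deduction_number; case: ex_minnP => k /existsP[L kL] k_min.
apply/eqP; rewrite eqn_leq k_min /=; last first.
  by apply/existsP; exists (cycle_layout _ hn); apply: cycle_layout_successful.
by rewrite leq_uphalf_double; have := leq_card_successful _ _ _ kL; rewrite card_ord.
Qed.
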